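(* Let $K$ be a division ring, $S$ a ring endomorphism of $K$, $D$ an $S$-derivation of $K$ and $R=K[t;S,D]$. Let $g,h$ be nonzero polynomials in $R$. Then $$\operatorname{rk} V(gh)=\operatorname{rk} V(h)+\operatorname{rk}\bigl(\operatorname{Im}\phi_h\cap V(g)\bigr).$$ In particular, $\operatorname{rk} V(gh)\le \operatorname{rk} V(h)+\operatorname{rk} V(g)$.
   Context: An $S$-derivation is an additive map $D:K\to K$ with $D(ab)=S(a)D(b)+D(a)b$. $R=K[t;S,D]$ is the Ore ring of skew polynomials $\sum a_it^i$ ($a_i\in K$) with $ta=S(a)t+D(a)$. For $f\in R$, $a\in K$ write $f=q\,(t-a)+b$ with $q\in R$, $b\in K$; then $f(a):=b$, and $V(f):=\{a\in K: f(a)=0\}$. A subset $\Delta\subseteq K$ is algebraic if some nonzero polynomial of $R$ vanishes at every element of $\Delta$. An element $a\in K$ is $P$-dependent over an algebraic set $\Delta$ if every polynomial of $R$ vanishing on $\Delta$ vanishes at $a$. A subset $B$ of an algebraic set $\Delta$ is a $P$-basis of $\Delta$ if no $b\in B$ is $P$-dependent over $B\setminus\{b\}$ and every element of $\Delta$ is $P$-dependent over $B$. The rank $\operatorname{rk}\Delta$ is the cardinality of a $P$-basis of $\Delta$. For $a\in K$ and $c\in K\setminus\{0\}$, $a^c:=S(c)ac^{-1}+D(c)c^{-1}$. For $h\in R$, $\phi_h:K\setminus V(h)\to K$ is the map $\phi_h(x):=x^{h(x)}$, with image $\operatorname{Im}\phi_h$. *)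

(* Defs.v *)
From HB Require Import structures.
From mathcomp Require Import all_boot all_order all_algebra.
From mathcomp Require Import finmap.
From mathcomp Require Import boolp classical_sets functions cardinality.

Set Implicit Arguments.
Unset Strict Implicit.
Unset Printing Implicit Defensive.

Import GRing.Theory.

Local Open Scope classical_set_scope.
Local Open Scope card_scope.
Local Open Scope ring_scope.

Definition division_ring (K : unitRingType) : Prop :=
  forall x : K, x != 0 -> x \is a GRing.unit.

Record sderivation (K : nzRingType) (S : K -> K) := SDerivation {
  sder :> {additive K -> K};
  sderM : forall a b : K, sder (a * b) = S a * sder b + sder a * b
}.

(** The polynomial [p] stands for the skew polynomial [\sum_i p`_i t^i], with
    coefficients on the left of the powers of [t]: this is the additive group
    [{poly K}] with another product. *)
Definition ore (K : nzRingType) (S : {rmorphism K -> K}) (D : sderivation S)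
  : Type := {poly K}.

Section OreRing.
Context {K : nzRingType} {S : {rmorphism K -> K}} {D : sderivation S}.

HB.instance Definition _ := GRing.Lmodule.copy (ore D) {poly K}.

Implicit Types p q r : {poly K}.

(** [t * \sum_i a_i t^i = \sum_i (S(a_i) t + D(a_i)) t^i] *)
Definition ore_tmul p : {poly K} := map_poly S p * 'X + map_poly D p.

Definition ore_mul p q : {poly K} :=
  \sum_(i < size p) p`_i *: iter i ore_tmul q.

Lemma ore_tmul_is_additive : zmod_morphism ore_tmul.
Proof. by move=> p q; rewrite /ore_tmul !raddfB mulrBl opprD addrACA. Qed.

HB.instance Definition _ :=
  GRing.isZmodMorphism.Build {poly K} {poly K} ore_tmul ore_tmul_is_additive.

Lemma ore_tmulZ a p : ore_tmul (a *: p) = S a *: ore_tmul p + D a *: p.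
Proof.
rewrite /ore_tmul; apply/polyP=> i.
rewrite !(coefD, coefZ, coefMX, coef_map, sderM) /= mulrDr addrA.
rewrite -!addrA; congr (_ + _).
by case: eqP; rewrite ?mulr0 // rmorphM.
Qed.

Lemma ore_mul_wide n p q : (size p <= n)%N ->
  ore_mul p q = \sum_(i < n) p`_i *: iter i ore_tmul q.
Proof.
move=> le_n; rewrite /ore_mul (big_ord_widen n (fun i => p`_i *: iter i ore_tmul q)) //.
rewrite big_mkcond; apply: eq_bigr => i _; case: ltnP => // le_i.
by rewrite nth_default ?scale0r.
Qed.

Lemma iter_ore_tmulB i : zmod_morphism (iter i ore_tmul).
Proof. by elim: i => [|i IH] p q //=; rewrite IH raddfB. Qed.

HB.instance Definition _ i :=
  GRing.isZmodMorphism.Build {poly K} {poly K} (iter i ore_tmul)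
    (iter_ore_tmulB i).

Lemma ore_mulDl : left_distributive ore_mul +%R.
Proof.
move=> p q r; pose n := maxn (size p) (size q).
rewrite !(@ore_mul_wide n) ?size_polyD ?leq_maxl ?leq_maxr // -big_split /=.
by apply: eq_bigr => i _; rewrite coefD scalerDl.
Qed.

Lemma ore_mulDr : right_distributive ore_mul +%R.
Proof.
move=> p q r; rewrite /ore_mul -big_split /=.
by apply: eq_bigr => i _; rewrite raddfD scalerDr.
Qed.

Lemma ore_mulZl a p q : ore_mul (a *: p) q = a *: ore_mul p q.
Proof.
rewrite (@ore_mul_wide (size p)) ?size_scale_leq // scaler_sumr.
by apply: eq_bigr => i _; rewrite coefZ scalerA.
Qed.

Lemma ore_mul0l q : ore_mul 0 q = 0.
Proof. by rewrite /ore_mul size_poly0 big_ord0. Qed.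

Lemma ore_mulXn n q : ore_mul 'X^n q = iter n ore_tmul q.
Proof.
rewrite /ore_mul size_polyXn big_ord_recr /= coefXn eqxx scale1r big1 ?add0r //.
by move=> i _; rewrite coefXn ltn_eqF ?scale0r.
Qed.

Lemma ore_mul_suml I (s : seq I) P (F : I -> {poly K}) q :
  ore_mul (\sum_(i <- s | P i) F i) q = \sum_(i <- s | P i) ore_mul (F i) q.
Proof.
by apply: (big_morph (ore_mul^~ q)) => [x y|]; rewrite ?ore_mulDl ?ore_mul0l.
Qed.

Lemma ore_tmulXn n : ore_tmul 'X^n = 'X^(n.+1).
Proof.
rewrite /ore_tmul map_polyXn exprSr; apply/polyP=> i.
rewrite coefD coef_map coefXn /=.
have D1 : D 1 = 0.
  by apply: (@addrI _ (D 1)); rewrite addr0 -{3}[1]mulr1 sderM rmorph1 mul1r mulr1.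
by case: eqP; rewrite ?D1 ?raddf0 addr0.
Qed.

Lemma iter_ore_tmul1 n : iter n ore_tmul 1 = 'X^n.
Proof. by elim: n => [|n /= ->]; rewrite ?expr0 ?ore_tmulXn. Qed.

Lemma ore_mul1l : left_id 1 ore_mul.
Proof. by move=> q; rewrite -(expr0 'X) ore_mulXn. Qed.

Lemma ore_mul1r : right_id 1 ore_mul.
Proof.
move=> p; rewrite /ore_mul -[RHS]coefK poly_def.
by apply: eq_bigr => i _; rewrite iter_ore_tmul1.
Qed.

Lemma ore_tmulA p q : ore_mul (ore_tmul p) q = ore_tmul (ore_mul p q).
Proof.
rewrite [in LHS](_ : p = \sum_(i < size p) p`_i *: 'X^i); last first.
  by rewrite -[LHS]coefK poly_def.
rewrite raddf_sum ore_mul_suml /= [ore_mul p q]/ore_mul raddf_sum; apply: eq_bigr => i _.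
by rewrite /= !ore_tmulZ ore_mulDl !ore_mulZl ore_tmulXn !ore_mulXn.
Qed.

Lemma ore_mulA : associative ore_mul.
Proof.
move=> p q r; rewrite [ore_mul p q]/ore_mul ore_mul_suml.
apply: eq_bigr => i _; rewrite ore_mulZl; congr (_ *: _).
by elim: (nat_of_ord i) => //= k ->; rewrite ore_tmulA.
Qed.

HB.instance Definition _ := GRing.Zmodule_isNzRing.Build (ore D)
  ore_mulA ore_mul1l ore_mul1r ore_mulDl ore_mulDr (oner_neq0 {poly K}).

End OreRing.

Section Evaluation.
Context {K : nzRingType} {S : {rmorphism K -> K}} (D : sderivation S).

Definition oreX : ore D := 'X.
Definition oreC (a : K) : ore D := a%:P.

Definition ore_eval (f : ore D) (a : K) : K :=
  xget 0 [set b | exists q : ore D, f = q * (oreX - oreC a) + oreC b].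

Definition vset (f : ore D) : set K := [set a | ore_eval f a = 0].

Definition algebraic (Delta : set K) : Prop :=
  exists2 f : ore D, f != 0 & Delta `<=` vset f.

Definition P_dependent (Delta : set K) (a : K) : Prop :=
  forall f : ore D, Delta `<=` vset f -> vset f a.

Definition P_basis (Delta B : set K) : Prop :=
  [/\ algebraic Delta, B `<=` Delta,
      forall b, B b -> ~ P_dependent (B `\ b) b
    & forall a, Delta a -> P_dependent B a].

(** Over a division ring, algebraic sets have P-bases and these are all finite
    with [rk Delta] elements: see [P_basis_exists] and [P_basis_rk]. *)
Definition rk (Delta : set K) : nat :=
  xget 0%N [set n | exists2 B, P_basis Delta B & B #= `I_n].

Lemma oreXM (f : ore D) : oreX * f = ore_tmul (D := D) f.
Proof. by rewrite /oreX -['X](expr1 'X) [LHS](ore_mulXn (D := D)). Qed.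

Lemma oreCM a (f : ore D) : oreC a * f = a *: f.
Proof.
have -> : oreC a = a *: (1 : ore D) by rewrite /oreC -alg_polyC.
by rewrite [LHS](ore_mulZl (D := D)) [ore_mul _ _](mul1r f).
Qed.

Lemma oreXC a : oreX * oreC a = oreC (S a) * oreX + oreC (D a).
Proof.
by rewrite oreXM oreCM /ore_tmul /oreC /oreX !map_polyC mul_polyC.
Qed.

Lemma oreC_is_zmod_morphism : zmod_morphism oreC.
Proof. by move=> a b; rewrite /oreC polyCB. Qed.

Lemma oreCMC a b : oreC (a * b) = oreC a * oreC b.
Proof. by rewrite oreCM /oreC polyCM mul_polyC. Qed.

HB.instance Definition _ :=
  GRing.isZmodMorphism.Build K (ore D) oreC oreC_is_zmod_morphism.

Lemma ore_tmul_monic (f : {poly K}) : f \is monic ->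
  ore_tmul (D := D) f \is monic /\ size (ore_tmul (D := D) f) = (size f).+1.
Proof.
move=> mf; have f0 := monic_neq0 mf.
have mSf : map_poly S f \is monic by apply: monic_map.
have sSf : size (map_poly S f) = size f.
  by apply: size_map_poly_id0; rewrite (monicP mf) rmorph1 oner_neq0.
have lt_sz : (size (map_poly D f) < size (map_poly S f * 'X)%R)%N.
  rewrite size_mulX ?monic_neq0 // ltnS sSf.
  exact: size_poly.
rewrite monicE /ore_tmul lead_coefDl // size_polyDl // size_mulX ?monic_neq0 //.
by rewrite lead_coefMX (monicP mSf) sSf.
Qed.

Lemma iter_ore_tmul_monic i (f : {poly K}) : f \is monic ->
  iter i (ore_tmul (D := D)) f \is monic /\
  size (iter i (ore_tmul (D := D)) f) = (size f + i)%N.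
Proof.
move=> mf; elim: i => [|i [IH1 IH2]] /=; first by rewrite addn0.
by have [-> ->] := ore_tmul_monic IH1; rewrite IH2 addnS.
Qed.

Definition osize (f : ore D) := size (f : {poly K}).

Lemma size_ore_mul_monic (p f : ore D) : p != 0 -> (f : {poly K}) \is monic ->
  osize (p * f) = (osize p + osize f).-1.
Proof.
rewrite /osize.
move=> p0 mf; rewrite [p * f]/(ore_mul (D := D) p f) /ore_mul.
have [n sp] : exists n, size (p : {poly K}) = n.+1.
  by exists (size (p : {poly K})).-1; rewrite prednK // size_poly_gt0.
rewrite sp big_ord_recr /=; set r := \sum_(i < n) _.
have [mn sn] := iter_ore_tmul_monic n mf.
have pn : (p : {poly K})`_n != 0.
  by rewrite -[n]/(n.+1.-1) -sp -lead_coefE lead_coef_eq0.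
have sz : size ((p : {poly K})`_n *: iter n (ore_tmul (D := D)) f)
          = (size (f : {poly K}) + n)%N.
  rewrite -sn -mul_polyC size_Mmonic ?polyC_eq0 //.
  by rewrite size_polyC pn.
have f0 : (0 < size (f : {poly K}))%N by rewrite size_poly_gt0 monic_neq0.
rewrite addrC size_polyDl sz ?addSn ?(addnC n) //.
apply: leq_ltn_trans (size_sum _ _ _) _.
have : (\max_(i < n) size ((p : {poly K})`_i *: iter i (ore_tmul (D := D)) f)
         <= (size (f : {poly K}) + n).-1)%N.
  apply/bigmax_leqP => i _; apply: leq_trans (size_scale_leq _ _) _.
  rewrite (iter_ore_tmul_monic i mf).2 -ltnS prednK ?addn_gt0 ?f0 //.
  by rewrite ltn_add2l.
by rewrite -ltnS prednK ?addn_gt0 ?f0.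
Qed.

Lemma oreXC_monic a : (oreX - oreC a : {poly K}) \is monic.
Proof. exact: monicXsubC. Qed.

Lemma ore_division (f : ore D) a :
  exists q : ore D, exists b, f = q * (oreX - oreC a) + oreC b.
Proof.
pose P (f : ore D) := exists q : ore D, exists b, f = q * (oreX - oreC a) + oreC b.
have P0 : P 0 by exists 0, 0; rewrite mul0r raddf0 addr0.
have PD g h : P g -> P h -> P (g + h).
  move=> [q [b ->]] [r [c ->]]; exists (q + r), (b + c).
  by rewrite mulrDl raddfD addrACA.
have PZ c g : P g -> P (c *: g).
  move=> [q [b ->]]; exists (c *: q), (c * b).
  by rewrite scalerDr -!oreCM mulrA oreCMC.
have PX g : P g -> P (ore_tmul (D := D) g).
  move=> [q [b ->]]; exists (oreX * q + oreC (S b)), (S b * a + D b).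
  rewrite -oreXM mulrDr mulrA oreXC mulrDl raddfD /= oreCMC -!addrA.
  by congr (_ + _); rewrite addrA mulrBr subrK.
have P1 : P 1 by exists 0, 1; rewrite mul0r add0r.
change (P f); have -> : f = \sum_(i < size (f : {poly K}))
    (f : {poly K})`_i *: iter i (ore_tmul (D := D)) 1.
  by rewrite -[LHS](mulr1 f).
apply: (big_ind P) => // i _; apply: PZ.
by elim: (nat_of_ord i) => //= n; apply: PX.
Qed.

Lemma ore_division_uniq (q r : ore D) a b c :
  q * (oreX - oreC a) + oreC b = r * (oreX - oreC a) + oreC c -> b = c.
Proof.
move=> /eqP; rewrite -subr_eq0 opprD addrACA -mulrBl -raddfB => /eqP h.
have [qr|qr] := eqVneq (q - r) 0.
  by move: h; rewrite qr mul0r add0r => /polyC_inj/eqP; rewrite subr_eq0 => /eqP.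
move/eqP: h; rewrite addr_eq0 -raddfN /= => /eqP /(congr1 osize).
rewrite (size_ore_mul_monic qr (oreXC_monic a)) {2}/osize size_XsubC addn2 /=.
move=> h; have : (osize (oreC (- (b - c))) <= 1)%N by apply: size_polyC_leq1.
by rewrite -h ltnS leqn0 size_poly_eq0 (negPf qr).
Qed.

Lemma ore_evalP (f : ore D) a b :
  (exists q : ore D, f = q * (oreX - oreC a) + oreC b) <-> ore_eval f a = b.
Proof.
have P (f' : ore D) : exists q : ore D,
    f' = q * (oreX - oreC a) + oreC (ore_eval f' a).
  by rewrite /ore_eval; case: xgetP => //= h; have [q [c E]] := ore_division f' a;
     case: (h c); exists q.
split=> [[q E]|<-]; last exact: P.
by have [r E'] := P f; apply: (@ore_division_uniq r q a); rewrite -E' -E.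
Qed.

Lemma vsetP (f : ore D) a :
  (exists q : ore D, f = q * (oreX - oreC a)) <-> vset f a.
Proof.
rewrite /vset /= -ore_evalP; split=> -[q ->]; exists q; by rewrite raddf0 addr0.
Qed.

End Evaluation.

Section Conjugation.
Context {K : unitRingType} {S : {rmorphism K -> K}} (D : sderivation S).

Definition sdconj (a c : K) : K := S c * a * c^-1 + D c * c^-1.

Definition phi (h : ore D) (x : K) : K := sdconj x (ore_eval h x).

End Conjugation.

Section Rank.
Context {K : unitRingType} (hK : division_ring K).
Context {S : {rmorphism K -> K}} (D : sderivation S).

Lemma vsetMl (q f : ore D) a : vset f a -> vset (q * f) a.
Proof. by move=> /vsetP[r ->]; apply/vsetP; exists (q * r); rewrite mulrA. Qed.

Lemma vset_oreXCM (f : ore D) a : ore_eval f a != 0 ->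
  vset ((oreX D - oreC D (phi f a)) * f) a.
Proof.
move=> e0; have [q E] := (ore_evalP f a _).2 erefl.
move: E; set e := ore_eval f a => E; apply/vsetP.
exists ((oreX D - oreC D (phi f a)) * q + oreC D (S e)).
rewrite {2}E mulrDr mulrA [RHS]mulrDl; congr (_ + _).
rewrite mulrBl oreXC mulrBr -!oreCMC -addrA -raddfB /=; congr (_ + _).
rewrite -raddfN /=; congr (oreC D _).
by rewrite /phi /sdconj -/e -mulrDl mulrVK ?hK // opprD addrC subrK.
Qed.

Definition lannihilator (s : seq K) (f : ore D) : Prop :=
  [/\ (f : {poly K}) \is monic, osize f = (size s).+1
    & forall p : ore D, [set` s] `<=` vset p <-> exists q, p = q * f].

Lemma lannihilator_nil : lannihilator [::] 1.
Proof.
split; [exact: monic1 | exact: size_poly1 |].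
by move=> p; split=> // _; exists p; rewrite mulr1.
Qed.

Lemma lannihilator_vset s f : lannihilator s f -> [set` s] `<=` vset f.
Proof. by case=> _ _ /(_ f) [_]; apply; exists 1; rewrite mul1r. Qed.

Lemma lannihilator_dependent s f a : lannihilator s f ->
  P_dependent D [set` s] a <-> vset f a.
Proof.
move=> sf; split=> [|fa p]; first by apply; apply: lannihilator_vset.
by case: sf => _ _ sf /sf[q ->]; apply: vsetMl.
Qed.

Lemma lannihilator_size s f (p : ore D) : lannihilator s f -> p != 0 ->
  [set` s] `<=` vset p -> (size s < osize p)%N.
Proof.
move=> [mf sf f_p] p0 /f_p[q E]; rewrite E size_ore_mul_monic //; last first.
  by apply: contra_neq p0 => q0; rewrite E q0 mul0r.
rewrite sf addnS /= -[X in (X < _)%N]add0n ltn_add2r size_poly_gt0.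
by apply: contra_neq p0 => q0; rewrite E q0 mul0r.
Qed.

Lemma lannihilator_cons s f a : lannihilator s f -> ~ vset f a ->
  exists f', lannihilator (a :: s) f'.
Proof.
move=> sf /eqP fa; have [mf zf f_p] := sf.
pose u : ore D := oreX D - oreC D (phi f a).
have u0 : u != 0 by exact: monic_neq0 (oreXC_monic _ _).
have ufa : vset (u * f) a by apply: vset_oreXCM.
exists (u * f); split.
- have E : u * f = ore_tmul (D := D) f - phi f a *: f.
    by rewrite mulrBl oreXM oreCM.
  have [mt st] := ore_tmul_monic D mf.
  rewrite E monicE lead_coefDl ?(monicP mt) // size_polyN st ltnS.
  exact: size_scale_leq.
- by rewrite size_ore_mul_monic // zf /osize size_XsubC.
- move=> p; split=> [ap|[q ->] b].
    have [q E] : exists q, p = q * f.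
      by apply/f_p => b sb; apply: ap; rewrite /= inE sb orbT.
    have [r [b Eq]] := ore_division q (phi f a).
    exists r; rewrite E Eq; suff -> : b = 0 by rewrite raddf0 addr0 mulrA.
    have /ore_evalP[w Ew] : vset p a by apply: ap; rewrite /= mem_head.
    have [v Ev] := (vsetP (u * f) a).2 ufa.
    have [z Ez] := (ore_evalP f a _).2 erefl.
    have H : (r * v + oreC D b * z) * (oreX D - oreC D a) + oreC D (b * ore_eval f a)
          = w * (oreX D - oreC D a) + oreC D 0.
      rewrite -Ew E Eq oreCMC mulrDl -addrA -(mulrA (oreC D b)) -mulrDr -Ez.
      by rewrite -mulrA -Ev mulrA -mulrDl.
    move/ore_division_uniq: H => H.
    by rewrite -[b](mulrK (hK fa)) H mul0r.
  rewrite /= inE => /orP[/eqP ->|sb]; first exact: vsetMl.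
  by rewrite mulrA; apply: vsetMl; apply: lannihilator_vset sf _ sb.
Qed.

Lemma P_dependent_sub A B a : A `<=` B ->
  P_dependent D A a -> P_dependent D B a.
Proof. by move=> AB h f Bf; apply: h => x /AB; apply: Bf. Qed.

Lemma lannihilator_indep B s :
  (forall b, B b -> ~ P_dependent D (B `\ b) b) ->
  uniq s -> [set` s] `<=` B -> exists f, lannihilator s f.
Proof.
move=> indB; elim: s => [|a s IH]; first by exists 1; apply: lannihilator_nil.
move=> /= /andP[as_ us] sB.
have [|f sf] := IH us; first by move=> b sb; apply: sB; rewrite /= inE sb orbT.
apply: (lannihilator_cons sf) => fa; apply: (indB a).
  by apply: sB; rewrite /= mem_head.
apply: (P_dependent_sub _ ((lannihilator_dependent a sf).2 fa)) => b /= sb.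
split; first by apply: sB; rewrite /= inE sb orbT.
by move=> /= ba; rewrite -ba sb in as_.
Qed.

Lemma card_seq (s : seq K) : uniq s -> [set` s] #= `I_(size s).
Proof.
move=> us; have -> : [set` s] = [set` [fset x in s]%fset].
  by apply/seteqP; split=> x /=; rewrite !inE.
by apply/card_eq_fsetP; rewrite card_fseq undup_id.
Qed.

Lemma P_basis_seq Delta B : P_basis D Delta B ->
  exists s f, [/\ uniq s, B = [set` s] & lannihilator s f].
Proof.
move=> [[p p0 Dp] BD indB _].
have [/finite_fsetP[F BF]|infB] := pselect (finite_set B).
  have [|f ff] := lannihilator_indep indB (fset_uniq F); first by rewrite BF.
  by exists F, f; split; rewrite ?fset_uniq.
have [F FB ltF] := infinite_set_fset (osize p) infB.
have [|f ff] := lannihilator_indep indB (fset_uniq F); first exact: FB.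
have := lannihilator_size ff p0 (subset_trans FB (subset_trans BD Dp)).
by rewrite ltnNge ltF.
Qed.

Lemma P_basis_le Delta B s f t g : P_basis D Delta B ->
  [set` t] `<=` Delta ->
  B = [set` s] -> lannihilator s f -> lannihilator t g -> (size t <= size s)%N.
Proof.
move=> [_ BD _ depB] tD EB sf tg; case: (sf) => mf zf _.
rewrite -ltnS -zf; apply: (lannihilator_size tg); first exact: monic_neq0 mf.
move=> a /tD /depB; rewrite EB; apply; exact: lannihilator_vset.
Qed.

Lemma P_basis_exists Delta : algebraic D Delta -> exists B, P_basis D Delta B.
Proof.
move=> algD; have [p p0 Dp] := algD.
have span : exists2 s : seq K, [set` s] `<=` Delta
    & forall a, Delta a -> P_dependent D [set` s] a.
  have : exists s f, lannihilator s f /\ [set` s] `<=` Delta.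
    by exists [::], 1; split=> //; apply: lannihilator_nil.
  move=> [s [f [sf sD]]].
  have [n] := ubnP (osize p - size s); elim: n s f sf sD => // n IH s f sf sD.
  have lts := lannihilator_size sf p0 (subset_trans sD Dp).
  have [[a Da fa]|nex] := pselect (exists2 a, Delta a & ~ vset f a); last first.
    move=> _; exists s => // a Da; apply/(lannihilator_dependent _ sf).
    by apply: contrapT => fa; apply: nex; exists a.
  have [f' sf'] := lannihilator_cons sf fa.
  rewrite ltnS => le_n; apply: (IH _ _ sf').
    by move=> b; rewrite /= inE => /orP[/eqP -> //|]; apply: sD.
  by rewrite /= subnS; apply: leq_trans le_n; rewrite prednK // subn_gt0.
have [s sD sdep] := span.
have [n] := ubnP (size s); elim: n s sD sdep => // n IH s sD sdep le_n.
have [indep|] := pselect (forall b, [set` s] b -> ~ P_dependent D ([set` s] `\ b) b).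
  by exists [set` s]; split.
move=> /existsNP[b] /not_implyP[sb /contrapT db].
have E : [set` s] `\ b = [set` [seq x <- s | x != b]].
  apply/seteqP; split=> x /=; rewrite mem_filter; first by move=> [-> /eqP ->].
  by move=> /andP[/eqP].
apply: (IH [seq x <- s | x != b]).
- by move=> x; rewrite /= mem_filter => /andP[_]; apply: sD.
- move=> a /sdep h g gs; apply: h => x sx.
  have [->|xb] := eqVneq x b; first by apply: db; rewrite E.
  by apply: gs; rewrite /= mem_filter xb.
- rewrite size_filter -ltnS; apply: leq_trans le_n; rewrite ltnS.
  rewrite -(count_predC (pred1 b) s) -[X in (X < _)%N]add0n ltn_add2r.
  by rewrite -has_count has_pred1.
Qed.

Lemma P_basis_rk Delta B : P_basis D Delta B -> B #= `I_(rk D Delta).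
Proof.
have fin B' : P_basis D Delta B' ->
    exists s f, [/\ B' = [set` s], B' #= `I_(size s) & lannihilator s f].
  move=> /P_basis_seq[s [f [us EB sf]]]; exists s, f; split=> //.
  by rewrite EB; apply: card_seq.
move=> bB; have [s [f [Es cs sf]]] := fin _ bB.
have [|B' bB' cB'] := @xgetPex _ 0%N [set n | exists2 B, P_basis D Delta B & B #= `I_n].
  by exists (size s), B.
rewrite -/(rk D Delta) in cB'; have [t [g [Et ct tg]]] := fin _ bB'.
have -> : rk D Delta = size t.
  apply/card_eq_II; apply: card_eq_trans ct; by rewrite card_eq_sym.
suff -> : size t = size s by [].
have [_ sD _ _] := bB; have [_ tD _ _] := bB'.
rewrite Es in sD; rewrite Et in tD.
by apply/eqP; rewrite eqn_leq (P_basis_le bB tD Es sf tg) (P_basis_le bB' sD Et tg sf).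
Qed.

End Rank.

(* Main.v *)
Require Import Defs.
From HB Require Import structures.
From mathcomp Require Import all_boot all_order all_algebra.
From mathcomp Require Import boolp classical_sets cardinality.

(** The proof rests on the product formula [(f h)(a) = f(phi_h(a)) h(a)],
    valid when [h(a) <> 0].  It gives [V(f h) = V(h) `|` phi_h^-1(V(f))], so the
    theorem says that [phi_h] turns P-dependence modulo [V(h)] into plain
    P-dependence.  One builds a P-basis of [V(g h)] by joining to a P-basis
    of [V(h)] one preimage under [phi_h] of each element of a P-basis of
    [Im phi_h `&` V(g)].

    The joined family is independent ([lannihilator_lift]): if [f] is the
    minimal polynomial of some of the chosen images, then [f h] vanishes on
    [V(h)] and on their preimages, so a P-dependence between preimages modulo
    [V(h)] yields one between the images.

    The joined family generates ([vset_of_phi_dependent]) by the less formal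
    converse.  Applied to a constant [v] in place of [h], the product formula
    reads [(p v)(a) = p(a^v) v], whose left side is additive in [v]; hence
    [a^(v + w)] is P-dependent on [a^v] and [a^w] when [v], [w] and [v + w] are
    nonzero.  Now if [x] and [a] have the same image under [phi_F], then
    [x = a^v] with [v = F(x)^-1 F(a)], and [(F (v - 1))(a) = F(x) v - F(a) = 0].
    So either [x = a], or [x] is P-dependent on [a] and the root [a^(v - 1)] of
    [F] ([vset_of_phi_eq]).  Running this along a list of preimages, with
    [F = f h] for [f] the minimal polynomial of the images already treated,
    gives the claim for any number of them. *)

Set Implicit Arguments.
Unset Strict Implicit.
Unset Printing Implicit Defensive.

Import GRing.Theory.

Local Open Scope classical_set_scope.
Local Open Scope ring_scope.

Section OreRank.
Context {K : unitRingType} (hK : division_ring K).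
Context {S : {rmorphism K -> K}} {D : sderivation S}.
Implicit Types (f g h p : ore D) (a b c u v x y : K) (s t : seq K).

(** * The product formula and conjugation *)

Lemma sderivation1 : D 1 = 0.
Proof.
by apply: (@addrI _ (D 1)); rewrite addr0 -{3}[1]mulr1 sderM rmorph1 mul1r mulr1.
Qed.

Lemma sdconj1 a : sdconj D a 1 = a.
Proof. by rewrite /sdconj sderivation1 rmorph1 invr1 !mulr1 mul1r addr0. Qed.

Lemma sdconjM a c u : c != 0 -> u != 0 ->
  sdconj D (sdconj D a c) u = sdconj D a (u * c).
Proof.
move=> c0 u0; rewrite /sdconj sderM rmorphM invrM ?hK //.
rewrite mulrDr !mulrDl -addrA; congr (_ + _); first by rewrite !mulrA.
by rewrite !mulrA mulrK ?hK.
Qed.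

Lemma division_mul_neq0 u v : u != 0 -> v != 0 -> u * v != 0.
Proof.
by move=> u0 v0; apply: contra_neq u0 => uv; rewrite -[u](mulrK (hK v0)) uv mul0r.
Qed.

Lemma division_inv_neq0 u : u != 0 -> u^-1 != 0.
Proof.
move=> u0; apply: contra_neq (oner_neq0 K) => v0.
by rewrite -(mulVr (hK u0)) v0 mul0r.
Qed.

Lemma ore_evalC v a : ore_eval (oreC D v) a = v.
Proof. by apply/ore_evalP; exists 0; rewrite mul0r add0r. Qed.

Lemma ore_evalB f g a : ore_eval (f - g) a = ore_eval f a - ore_eval g a.
Proof.
have [q Ef] := (ore_evalP f a _).2 erefl.
have [r Eg] := (ore_evalP g a _).2 erefl.
by apply/ore_evalP; exists (q - r); rewrite {1}Ef {1}Eg mulrBl raddfB opprD addrACA.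
Qed.

Lemma ore_evalM f h a : ore_eval h a != 0 ->
  ore_eval (f * h) a = ore_eval f (phi h a) * ore_eval h a.
Proof.
move=> ha; have [q Ef] := (ore_evalP f (phi h a) _).2 erefl.
have [r Er] := (vsetP _ _).2 (vset_oreXCM hK ha).
have [z Eh] := (ore_evalP h a _).2 erefl.
apply/ore_evalP; exists (q * r + oreC D (ore_eval f (phi h a)) * z).
rewrite {1}Ef mulrDl -mulrA Er [X in _ + _ * X = _]Eh [oreC _ _ * (_ + _)]mulrDr -oreCMC.
by rewrite [(_ + _) * (oreX D - _)]mulrDl !mulrA addrA.
Qed.

Lemma ore_evalMC f v a : v != 0 ->
  ore_eval (f * oreC D v) a = ore_eval f (sdconj D a v) * v.
Proof. by move=> v0; rewrite ore_evalM /phi ore_evalC. Qed.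

Lemma vsetM f h a : ~ vset h a -> vset (f * h) a <-> vset f (phi h a).
Proof.
move=> /eqP ha; rewrite /vset /= ore_evalM //; split=> [|->]; last by rewrite mul0r.
by move=> fh; apply/eqP; apply: contraPT fh => f0; apply/eqP; apply: division_mul_neq0.
Qed.

Lemma phiM f h a : ~ vset h a -> ~ vset f (phi h a) ->
  phi (f * h) a = phi f (phi h a).
Proof. by move=> /eqP ha /eqP fa; rewrite /phi sdconjM // ore_evalM. Qed.

Lemma vsetXC a b : vset (oreX D - oreC D a) b <-> b = a.
Proof.
have E : ore_eval (oreX D - oreC D a) b = b - a.
  by apply/ore_evalP; exists 1; rewrite mul1r raddfB addrA subrK.
by rewrite /vset /= E; split=> [/subr0_eq|->]; rewrite ?subrr.
Qed.

(** * P-dependence and the maps [phi_f] *)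

(** With [v = f(x)^-1 f(a)] one has [x = a^v], and the polynomials
    [f (v - 1)] and [p (v - 1)] take at [a] the values [f(x) v - f(a) = 0] and
    [p(x) v - p(a)]; if [v <> 1], the first makes [a^(v - 1)] a root of [f],
    hence of [p], and then the second one vanishes as well, so [p(x) v = 0]. *)
Lemma vset_of_phi_eq f p a x : ~ vset f a -> ~ vset f x ->
  phi f x = phi f a -> vset f `<=` vset p -> vset p a -> vset p x.
Proof.
move=> /eqP fa /eqP fx Efx fp pa; set v := (ore_eval f x)^-1 * ore_eval f a.
have fx' := division_inv_neq0 fx.
have v0 : v != 0 by apply: division_mul_neq0.
have Ex : x = sdconj D a v.
  rewrite /v -sdconjM // -[sdconj D a _]/(phi f a) -Efx /phi sdconjM //.
  by rewrite mulVr ?hK // sdconj1.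
have [v1|v1] := eqVneq (v - 1) 0.
  by rewrite Ex (subr0_eq v1) sdconj1.
have eval_v1 (q : ore D) :
    ore_eval q (sdconj D a (v - 1)) * (v - 1) = ore_eval q x * v - ore_eval q a.
  rewrite Ex -!ore_evalMC // -ore_evalB; congr (ore_eval _ a).
  by rewrite raddfB mulrBr mulr1.
have fz : vset f (sdconj D a (v - 1)).
  apply: contrapT => /eqP fz.
  have := division_mul_neq0 fz v1.
  by rewrite eval_v1 /v mulrA mulrV ?hK // mul1r subrr eqxx.
have := eval_v1 p; rewrite (fp _ fz) pa mul0r subr0 => /esym pxv.
apply: contrapT => /eqP px.
by have := division_mul_neq0 px v0; rewrite pxv eqxx.
Qed.

(** Such an [f] plays the role of a minimal polynomial for a possibly
    dependent [s].  An element [a] outside [V(f)] is added by the left factor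
    [t - phi_f(a)]; the new roots are the [x] with [phi_f(x) = phi_f(a)], which
    [vset_of_phi_eq] shows to depend on [a] and [V(f)]. *)
Lemma P_closure_seq s : exists f, [set` s] `<=` vset f /\
  forall a, vset f a -> P_dependent D [set` s] a.
Proof.
elim: s => [|a s [f [sf fs]]].
  exists 1; split=> [x //|x]; rewrite /vset /= -[1]/(oreC D 1) ore_evalC.
  by move=> /eqP; rewrite oner_eq0.
have [fa|fa] := pselect (vset f a).
  exists f; split=> [x|x /fs fx]; first by rewrite /= inE => /orP[/eqP->|/sf].
  by apply: P_dependent_sub fx => y; rewrite /= inE => ->; rewrite orbT.
exists ((oreX D - oreC D (phi f a)) * f); split=> [x|x fx p ap].
  rewrite /= inE => /orP[/eqP->|/sf]; last exact: vsetMl.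
  by apply: vset_oreXCM => //; apply/eqP.
have sp : vset f `<=` vset p.
  by move=> y /fs; apply=> z sz; apply: ap; rewrite /= inE sz orbT.
have [/sp //|fx0] := pselect (vset f x).
have pa : vset p a by apply: ap; rewrite /= mem_head.
by move/vsetM: fx => /(_ fx0)/vsetXC Ex; exact: (vset_of_phi_eq fa fx0 Ex sp pa).
Qed.

(** If [phi_h(x)] depends on the images of [a :: s] but not on those of [s],
    and [f] is a minimal polynomial of the latter, then [t - phi_f(phi_h(a))]
    kills [phi_f(phi_h(x))], so that [x] and [a] have the same image under
    [phi_(f h)]. *)
Lemma vset_of_phi_dependent h p s x :
  [set` s] `<=` ~` vset h -> vset h `<=` vset p -> [set` s] `<=` vset p ->
  ~ vset h x -> P_dependent D [set` map (phi h) s] (phi h x) -> vset p x.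
Proof.
move=> sh hp; elim: s x sh => [|a s IH] x sh sp hx dx.
  have /eqP : vset (1 : ore D) (phi h x) by apply: dx.
  by rewrite -[1]/(oreC D 1) ore_evalC oner_eq0.
have {}IH y : ~ vset h y -> P_dependent D [set` map (phi h) s] (phi h y) -> vset p y.
  by apply: IH => z sz; [apply: sh | apply: sp]; rewrite /= inE sz orbT.
have ha : ~ vset h a by apply: sh; rewrite /= mem_head.
have pa : vset p a by apply: sp; rewrite /= mem_head.
have [f [sf fs]] := P_closure_seq (map (phi h) s).
have [/fs/(IH _ hx) //|fx] := pselect (vset f (phi h x)).
have fa : ~ vset f (phi h a).
  by move=> fa; apply/fx/dx => y; rewrite /= inE => /orP[/eqP->|/sf].
have Efx : phi f (phi h x) = phi f (phi h a).
  apply/vsetXC/(vsetM _ fx)/dx => y; rewrite /= inE => /orP[/eqP->|/sf].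
    by apply: vset_oreXCM => //; apply/eqP.
  exact: vsetMl.
have fhx : ~ vset (f * h) x := contra_not (vsetM f hx).1 fx.
have fha : ~ vset (f * h) a := contra_not (vsetM f ha).1 fa.
have Ephi := etrans (phiM hx fx) (etrans Efx (esym (phiM ha fa))).
have fhp : vset (f * h) `<=` vset p.
  move=> y; have [hy _|hy /(vsetM _ hy)/fs] := pselect (vset h y); first exact: hp.
  exact: IH.
exact: (vset_of_phi_eq fha fhx Ephi fhp pa).
Qed.

(** * Ranks *)

(** Exhibiting a [lannihilator] of [s] expresses at once that the entries of
    [s] are distinct and P-independent. *)
Lemma rk_lannihilator Delta s f : lannihilator s f ->
  [set` s] `<=` Delta -> Delta `<=` vset f -> rk D Delta = size s.
Proof.
move=> sf sD Df; have [mf zf _] := sf.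
have [|B bB] := @P_basis_exists _ hK _ D Delta.
  by exists f => //; exact: monic_neq0 mf.
have [t [g [ut EB tg]]] := P_basis_seq hK bB.
have -> : rk D Delta = size t.
  apply/card_eq_II; apply: card_eq_trans (card_seq ut); rewrite -EB card_eq_sym.
  exact: P_basis_rk bB.
have [_ BD _ _] := bB.
apply/eqP; rewrite eqn_leq (P_basis_le bB sD EB tg sf) andbT.
rewrite -ltnS -zf; apply: (lannihilator_size tg); first exact: monic_neq0 mf.
by rewrite -EB; apply: subset_trans Df.
Qed.

Lemma rk_subset Delta E : algebraic D E -> Delta `<=` E ->
  (rk D Delta <= rk D E)%N.
Proof.
move=> algE DE; have [p p0 Ep] := algE.
have [B bB] := P_basis_exists hK algE.
have [t [g [_ EB tg]]] := P_basis_seq hK bB.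
have [_ BE _ depB] := bB; rewrite EB in BE depB.
have [C bC] := @P_basis_exists _ hK _ D Delta (ex_intro2 _ _ p p0 (subset_trans DE Ep)).
have [s [f [_ EC sf]]] := P_basis_seq hK bC.
have [_ CD _ depC] := bC; rewrite EC in CD depC.
have closed r q F : @lannihilator _ _ D r q ->
    (forall a, F a -> P_dependent D [set` r] a) -> F `<=` vset q.
  by move=> rq dF a /dF/(lannihilator_dependent _ rq).
rewrite (rk_lannihilator tg BE (closed _ _ _ tg depB)).
rewrite (rk_lannihilator sf CD (closed _ _ _ sf depC)).
exact: P_basis_le bB (subset_trans CD DE) EB tg sf.
Qed.

(** If [f] is a minimal polynomial of the images of [s'], then [f h] vanishes
    on [s] and on [s']; an element [a] P-dependent on these is thus a root of
    [f h], so that [phi_h(a)] is P-dependent on the images of [s'].  Hence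
    independent images allow [s'] to be added to [s] one element at a time. *)
Lemma lannihilator_lift h B s s' p :
  (forall b, B b -> ~ P_dependent D (B `\ b) b) ->
  lannihilator s p -> [set` s] `<=` vset h -> [set` s'] `<=` ~` vset h ->
  uniq (map (phi h) s') -> [set` map (phi h) s'] `<=` B ->
  exists f, lannihilator (s' ++ s) f.
Proof.
move=> indB sp sh; elim: s' => [|a s' IH] s'h /=; first by exists p.
move=> /andP[as' us'] sB.
have [b sb|//|b sb|w s'w] := IH.
- by apply: s'h; rewrite /= inE sb orbT.
- by apply: sB; rewrite /= inE sb orbT.
apply: (lannihilator_cons hK s'w) => wa.
have ha : ~ vset h a by apply: s'h; rewrite /= mem_head.
have [f [sf fs]] := P_closure_seq (map (phi h) s').
apply: (indB (phi h a)); first by apply: sB; rewrite /= mem_head.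
suff fa : vset f (phi h a).
  apply: (P_dependent_sub _ (fs _ fa)) => b sb; split.
    by apply: sB; rewrite /= inE sb orbT.
  by move=> /= ba; rewrite -ba sb in as'.
apply/(vsetM _ ha)/((lannihilator_dependent _ s'w).2 wa) => b.
rewrite /= mem_cat => /orP[sb|/sh]; last exact: vsetMl.
have hb : ~ vset h b by apply: s'h; rewrite /= inE sb orbT.
by apply/(vsetM _ hb)/sf; apply: map_f.
Qed.

Lemma map_preimage (T U : eqType) (F : T -> U) (A : set T) (t : seq U) :
  [set` t] `<=` F @` A -> exists2 s, [set` s] `<=` A & map F s = t.
Proof.
elim: t => [|b t IH] tA; first by exists [::].
have [|s sA <-] := IH; first by move=> c tc; apply: tA; rewrite /= inE tc orbT.
have [|a Aa <-] := tA b; first by rewrite /= mem_head.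
by exists (a :: s) => // c; rewrite /= inE => /orP[/eqP->|/sA].
Qed.

Lemma rk_vsetM g h : g != 0 -> h != 0 ->
  rk D (vset (g * h)) =
    (rk D (vset h) + rk D ((phi h @` (~` vset h)) `&` vset g))%N.
Proof.
move=> g0 h0; set I := _ `&` _.
have algh : algebraic D (vset h) by exists h.
have algI : algebraic D I by exists g => // x [].
have [B bB] := P_basis_exists hK algh.
have [s [u [_ EB su]]] := P_basis_seq hK bB.
have [_ sh _ dep_s] := bB; rewrite EB in sh dep_s.
have [C bC] := P_basis_exists hK algI.
have [t [v [ut EC tv]]] := P_basis_seq hK bC.
have [_ CI indC dep_t] := bC; rewrite EC in CI dep_t.
have [s' s'h Et] := map_preimage (subset_trans CI (@subIsetl _ _ _)).
have [||f s'f] := lannihilator_lift indC su sh s'h; rewrite ?Et ?EC //.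
have -> : rk D (vset h) = size s.
  by apply: (rk_lannihilator su sh) => a /dep_s/(lannihilator_dependent _ su).
have -> : rk D I = size s'.
  rewrite -(size_map (phi h)) Et.
  by apply: (rk_lannihilator tv CI) => a /dep_t/(lannihilator_dependent _ tv).
rewrite addnC -size_cat; have f_s's := lannihilator_vset s'f.
apply: (rk_lannihilator s'f) => a /=.
  rewrite mem_cat => /orP[sa|/sh]; last exact: vsetMl.
  apply/(vsetM _ (s'h a sa)); have [] // := CI (phi h a).
  by rewrite -Et /=; apply: map_f.
have hf : vset h `<=` vset f.
  by move=> b /dep_s; apply=> c sc; apply: f_s's; rewrite /= mem_cat sc orbT.
have [/hf //|ha] := pselect (vset h a).
move=> /(vsetM _ ha) ga; apply: (vset_of_phi_dependent s'h hf _ ha).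
  by move=> c sc; apply: f_s's; rewrite /= mem_cat sc.
by rewrite Et; apply: dep_t; split=> //; exists a.
Qed.

End OreRank.

Theorem theorem3p4 (K : unitRingType) (hK : division_ring K)
    (S : {rmorphism K -> K}) (D : sderivation S) (g h : ore D)
    (hg : g != 0) (hh : h != 0) :
  (rk D (vset (g * h)%R) =
     rk D (vset h) + rk D ((phi h @` (~` vset h)) `&` vset g))%N /\
  (rk D (vset (g * h)%R) <= rk D (vset h) + rk D (vset g))%N.
Proof.
rewrite rk_vsetM //; split=> //; rewrite leq_add2l.
by apply: (rk_subset hK) => [|x []//]; exists g.
Qed.
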